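(* The functor $\varTheta:\mathbf{FinRing}\to\mathbf{Digraph}$ preserves finite products.
   Context: $\mathbf{FinRing}$ is the category of finite unital rings (including the zero ring) and unital ring homomorphisms. $\mathbf{Digraph}$ is the category of directed graphs (loops allowed, at most one edge from $u$ to $v$ for each ordered pair $(u,v)$) and graph homomorphisms (maps on vertices sending edges to edges). For a finite unital ring $R$, define $a\sim b$ if and only if $a=bu=vb$ for some units $u,v\in R$; this is an equivalence relation, and $[a]$ denotes the class of $a$. $\varTheta(R)$ is the directed graph whose vertices are the classes $[a]$, $a\in R$, with a directed edge $[x]\to[y]$ ($[x]$, $[y]$ not necessarily distinct) if and only if $xy=0$ (this is well defined). For a unital ring homomorphism $f:R\to S$, $\varTheta(f):\varTheta(R)\to\varTheta(S)$ is given by $\varTheta(f)([x])=[f(x)]$. Binary products in $\mathbf{FinRing}$ are direct products of rings and the final object is the zero ring. Binary products in $\mathbf{Digraph}$ are tensor products: $G\times H$ has vertex set $V(G)\times V(H)$ and an edge $(g,h)\to(g',h')$ if and only if there are edges $g\to g'$ in $G$ and $h\to h'$ in $H$; the final object is the graph with one vertex and one directed loop. *)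

(* Defs.v *)
From HB Require Import structures.
From mathcomp Require Import all_boot all_order all_algebra.
From mathcomp Require Import generic_quotient boolp.

Set Implicit Arguments.
Unset Strict Implicit.
Unset Printing Implicit Defensive.

Import GRing.Theory.
Local Open Scope ring_scope.
Local Open Scope quotient_scope.

Record category := Category {
  Ob :> Type;
  Hom : Ob -> Ob -> Type;
  idmap : forall A, Hom A A;
  compose : forall A B C, Hom B C -> Hom A B -> Hom A C;
  compose1f : forall A B (f : Hom A B), compose (idmap B) f = f;
  composef1 : forall A B (f : Hom A B), compose f (idmap A) = f;
  composeA : forall A B C D (h : Hom C D) (g : Hom B C) (f : Hom A B),
    compose h (compose g f) = compose (compose h g) f
}.

Record functor (C D : category) := Functor {
  fobj :> C -> D;
  fmap : forall A B : C, Hom A B -> Hom (fobj A) (fobj B);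
  fmap1 : forall A : C, fmap (idmap A) = idmap (fobj A);
  fmap_compose : forall (A B E : C) (g : Hom B E) (f : Hom A B),
    fmap (compose g f) = compose (fmap g) (fmap f)
}.

Definition is_product (C : category) (I : Type) (X : I -> C)
    (P : C) (p : forall i, Hom P (X i)) : Prop :=
  forall (Q : C) (q : forall i, Hom Q (X i)),
    exists! h : Hom Q P, forall i, compose (p i) h = q i.

(* The index type may be empty, so final objects are included. *)
Definition preserves_finite_products (C D : category) (F : functor C D) : Prop :=
  forall (I : finType) (X : I -> C) (P : C) (p : forall i, Hom P (X i)),
    is_product p -> is_product (fun i => fmap F (p i)).

Lemma rmorphism_eq (R S : pzSemiRingType) (f g : {rmorphism R -> S}) :
  f =1 g -> f = g.
Proof.
case: f g => [f [[[f0 fD]] [fM]]] [g [[[g0 gD]] [gM]]] /= /funext efg.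
rewrite efg in f0 fD fM *.
by rewrite (Prop_irrelevance f0 g0) (Prop_irrelevance fD gD)
  (Prop_irrelevance fM gM).
Qed.

(* [finPzRingType] includes the zero ring, unlike [finNzRingType]. *)
Definition FinRing : category.
Proof.
refine (@Category finPzRingType (fun R S => {rmorphism R -> S})
  (fun R => idfun : {rmorphism R -> R})
  (fun R S T (g : {rmorphism S -> T}) (f : {rmorphism R -> S}) =>
     (g \o f : {rmorphism R -> T})) _ _ _).
- by move=> R S f; apply: rmorphism_eq.
- by move=> R S f; apply: rmorphism_eq.
- by move=> R S T U h g f; apply: rmorphism_eq.
Defined.

Record digraph := MkDigraph {
  vertex :> Type;
  edge : vertex -> vertex -> Prop
}.

Record digraph_hom (G H : digraph) := DigraphHom {
  vmap :> G -> H;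
  vmap_edge : forall x y : G, edge x y -> edge (vmap x) (vmap y)
}.

Lemma digraph_hom_eq (G H : digraph) (f g : digraph_hom G H) : f =1 g -> f = g.
Proof.
case: f g => [f fE] [g gE] /= /funext efg.
by rewrite efg in fE *; rewrite (Prop_irrelevance fE gE).
Qed.

Definition digraph_id (G : digraph) : digraph_hom G G :=
  @DigraphHom G G id (fun x y exy => exy).

Definition digraph_comp (G H K : digraph)
    (g : digraph_hom H K) (f : digraph_hom G H) : digraph_hom G K :=
  @DigraphHom G K (g \o f) (fun x y exy => vmap_edge g (vmap_edge f exy)).

Definition Digraph : category.
Proof.
refine (@Category digraph digraph_hom digraph_id digraph_comp _ _ _).
- by move=> G H f; apply: digraph_hom_eq.
- by move=> G H f; apply: digraph_hom_eq.
- by move=> G H K L h g f; apply: digraph_hom_eq.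
Defined.

(* [GRing.unit] is unavailable here: it requires a nontrivial ring. *)
Definition is_unit (R : finPzRingType) (u : R) : bool :=
  [exists v : R, (u * v == 1) && (v * u == 1)].

Definition assoc_rel (R : finPzRingType) (a b : R) : bool :=
  [exists u : R, exists v : R,
    [&& is_unit u, is_unit v, a == b * u & a == v * b]].

Lemma is_unitP (R : finPzRingType) (u : R) :
  reflect (exists v, u * v = 1 /\ v * u = 1) (is_unit u).
Proof.
apply: (iffP existsP) => [[v /andP[/eqP uv /eqP vu]]|[v [uv vu]]]; exists v => //.
by rewrite uv vu !eqxx.
Qed.

Lemma assoc_relP (R : finPzRingType) (a b : R) :
  reflect (exists u v, [/\ is_unit u, is_unit v, a = b * u & a = v * b])
          (assoc_rel a b).
Proof.
apply: (iffP existsP) => [[u /existsP[v /and4P[uu uv /eqP au /eqP av]]]|].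
  by exists u, v.
case=> u [v [uu uv au av]]; exists u; apply/existsP; exists v.
by rewrite uu uv -au -av !eqxx.
Qed.

Lemma is_unit1 (R : finPzRingType) : is_unit (1 : R).
Proof. by apply/is_unitP; exists 1; rewrite mulr1. Qed.

Lemma is_unitM (R : finPzRingType) (u v : R) :
  is_unit u -> is_unit v -> is_unit (u * v).
Proof.
move=> /is_unitP[u' [uu' u'u]] /is_unitP[v' [vv' v'v]].
apply/is_unitP; exists (v' * u'); split.
  by rewrite mulrA -(mulrA u) vv' mulr1.
by rewrite mulrA -(mulrA v') u'u mulr1.
Qed.

Lemma is_unit_rmorph (R S : finPzRingType) (f : {rmorphism R -> S}) (u : R) :
  is_unit u -> is_unit (f u).
Proof.
move=> /is_unitP[v [uv vu]]; apply/is_unitP; exists (f v).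
by rewrite -!rmorphM uv vu rmorph1.
Qed.

Lemma assoc_rel_refl (R : finPzRingType) : reflexive (@assoc_rel R).
Proof.
by move=> a; apply/assoc_relP; exists 1, 1; rewrite is_unit1 mulr1 mul1r.
Qed.

Lemma assoc_rel_sym (R : finPzRingType) : symmetric (@assoc_rel R).
Proof.
suff H (a b : R) : assoc_rel a b -> assoc_rel b a by move=> a b; apply/idP/idP; apply: H.
move=> /assoc_relP[u [v [/is_unitP[u' [uu' u'u]] /is_unitP[v' [vv' v'v]] au av]]].
apply/assoc_relP; exists u', v'; split.
- by apply/is_unitP; exists u.
- by apply/is_unitP; exists v.
- by rewrite au -mulrA uu' mulr1.
- by rewrite av mulrA v'v mul1r.
Qed.

Lemma assoc_rel_trans (R : finPzRingType) : transitive (@assoc_rel R).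
Proof.
move=> b a c /assoc_relP[u [v [uu uv au av]]] /assoc_relP[u' [v' [uu' uv' bu bv]]].
apply/assoc_relP; exists (u' * u), (v * v'); split.
- exact: is_unitM.
- exact: is_unitM.
- by rewrite au bu mulrA.
- by rewrite av bv mulrA.
Qed.

Canonical assoc_equiv (R : finPzRingType) : equiv_rel R :=
  EquivRel (@assoc_rel R)
    (@assoc_rel_refl R) (@assoc_rel_sym R) (@assoc_rel_trans R).

Definition assoc_class (R : finPzRingType) : Type := {eq_quot (assoc_equiv R)}.

Definition class_of (R : finPzRingType) (a : R) : assoc_class R :=
  \pi_({eq_quot (assoc_equiv R)}) a.

Lemma class_ofP (R : finPzRingType) (a b : R) :
  reflect (class_of a = class_of b) (assoc_rel a b).
Proof. exact: (eqquotP {eq_quot (assoc_equiv R)} a b). Qed.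

Lemma class_of_surj (R : finPzRingType) (A : assoc_class R) :
  exists a, A = class_of a.
Proof.
by exists (repr (A : {eq_quot (assoc_equiv R)})); rewrite /class_of reprK.
Qed.

Definition theta_edge (R : finPzRingType) (A B : assoc_class R) : Prop :=
  exists x y : R, [/\ A = class_of x, B = class_of y & x * y = 0].

Lemma theta_edgeE (R : finPzRingType) (x y : R) :
  theta_edge (class_of x) (class_of y) <-> x * y = 0.
Proof.
split=> [[x' [y' [/class_ofP/assoc_relP ex /class_ofP/assoc_relP ey xy0]]]|xy0].
  case: ex => _ [v [_ _ _ ->]]; case: ey => u [_ [_ _ -> _]].
  by rewrite -mulrA (mulrA x') xy0 mul0r mulr0.
by exists x, y.
Qed.

Definition theta_obj (R : finPzRingType) : digraph :=
  @MkDigraph (assoc_class R) (@theta_edge R).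

Definition theta_vmap (R S : finPzRingType) (f : {rmorphism R -> S})
    (A : assoc_class R) : assoc_class S :=
  class_of (f (repr (A : {eq_quot (assoc_equiv R)}))).

Lemma theta_vmapE (R S : finPzRingType) (f : {rmorphism R -> S}) (x : R) :
  theta_vmap f (class_of x) = class_of (f x).
Proof.
rewrite /theta_vmap; set y := repr _.
have /class_ofP/assoc_relP[u [v [uu uv yu yv]]] : class_of y = class_of x.
  by rewrite /y /class_of reprK.
apply/class_ofP/assoc_relP; exists (f u), (f v); split.
- exact: is_unit_rmorph.
- exact: is_unit_rmorph.
- by rewrite -rmorphM -yu.
- by rewrite -rmorphM -yv.
Qed.

Lemma theta_vmap_edge (R S : finPzRingType) (f : {rmorphism R -> S})
    (A B : theta_obj R) :
  edge A B -> @edge (theta_obj S) (theta_vmap f A) (theta_vmap f B).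
Proof.
case=> x [y [-> -> xy0]]; rewrite !theta_vmapE.
by apply/theta_edgeE; rewrite -rmorphM xy0 rmorph0.
Qed.

Definition theta_hom (R S : finPzRingType) (f : {rmorphism R -> S}) :
    digraph_hom (theta_obj R) (theta_obj S) :=
  @DigraphHom (theta_obj R) (theta_obj S) (theta_vmap f) (@theta_vmap_edge R S f).

Definition Theta : functor FinRing Digraph.
Proof.
refine (@Functor FinRing Digraph theta_obj theta_hom _ _).
- move=> R; apply: digraph_hom_eq => A /=.
  by have [x ->] := class_of_surj A; rewrite theta_vmapE.
- move=> R S T g f; apply: digraph_hom_eq => A /=.
  by have [x ->] := class_of_surj A; rewrite !theta_vmapE.
Defined.

(* Main.v *)
Require Import Defs.
From HB Require Import structures.
From mathcomp Require Import all_boot all_algebra boolp.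

(** A categorical product of finite rings is compared with the concrete ring of
    families, so that its elements correspond bijectively to families of
    elements of the factors.  Zero products, units, and therefore edges and
    association, can then be checked factor by factor. *)

Set Implicit Arguments.
Unset Strict Implicit.
Unset Printing Implicit Defensive.

Import GRing.Theory.
Local Open Scope ring_scope.

(** Inverses, units and representatives are found one factor at a time, in types that vary with the
    index; this collects them into one family. *)
Lemma dep_choice (I : Type) (X : I -> Type) (R : forall i, X i -> Prop) :
  (forall i, exists x, R i x) -> exists f, forall i, R i (f i).
Proof.
by move=> ex; exists (fun i => sval (cid (ex i))) => i; apply: svalP (cid (ex i)).
Qed.

(* An alias, because [{dffun _}] itself carries the multiplicative group
   structure of [gproduct]. *)
Definition dprod_ring (I : finType) (X : I -> finPzRingType) : Type :=
  {dffun forall i, X i}.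

HB.instance Definition _ (I : finType) (X : I -> finPzRingType) :=
  Finite.copy (dprod_ring X) {dffun forall i, X i}.

Section DProdRing.
Variables (I : finType) (X : I -> finPzRingType).
Implicit Types f g h : dprod_ring X.

Definition dprod_of (x : forall i, X i) : dprod_ring X := [ffun i => x i].

Definition dprod_proj (i : I) (f : dprod_ring X) : X i :=
  (f : {dffun forall i, X i}) i.

Lemma dprod_projE (x : forall i, X i) i : dprod_proj i (dprod_of x) = x i.
Proof. exact: ffunE. Qed.

Lemma dprod_projP f g : (forall i, dprod_proj i f = dprod_proj i g) -> f = g.
Proof. by move=> fg; apply/ffunP. Qed.

Definition dprod_opp f := dprod_of (fun i => - dprod_proj i f).
Definition dprod_add f g := dprod_of (fun i => dprod_proj i f + dprod_proj i g).
Definition dprod_mul f g := dprod_of (fun i => dprod_proj i f * dprod_proj i g).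

Fact dprod_addA : associative dprod_add.
Proof. by move=> f g h; apply: dprod_projP => i; rewrite !dprod_projE addrA. Qed.
Fact dprod_addC : commutative dprod_add.
Proof. by move=> f g; apply: dprod_projP => i; rewrite !dprod_projE addrC. Qed.
Fact dprod_add0 : left_id (dprod_of (fun=> 0)) dprod_add.
Proof. by move=> f; apply: dprod_projP => i; rewrite !dprod_projE add0r. Qed.
Fact dprod_addN : left_inverse (dprod_of (fun=> 0)) dprod_opp dprod_add.
Proof. by move=> f; apply: dprod_projP => i; rewrite !dprod_projE addNr. Qed.

HB.instance Definition _ := GRing.isZmodule.Build (dprod_ring X)
  dprod_addA dprod_addC dprod_add0 dprod_addN.

Fact dprod_mulA : associative dprod_mul.
Proof. by move=> f g h; apply: dprod_projP => i; rewrite !dprod_projE mulrA. Qed.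
Fact dprod_mul1 : left_id (dprod_of (fun=> 1)) dprod_mul.
Proof. by move=> f; apply: dprod_projP => i; rewrite !dprod_projE mul1r. Qed.
Fact dprod_mulr1 : right_id (dprod_of (fun=> 1)) dprod_mul.
Proof. by move=> f; apply: dprod_projP => i; rewrite !dprod_projE mulr1. Qed.
Fact dprod_mulDl : left_distributive dprod_mul +%R.
Proof. by move=> f g h; apply: dprod_projP => i; rewrite !dprod_projE mulrDl. Qed.
Fact dprod_mulDr : right_distributive dprod_mul +%R.
Proof. by move=> f g h; apply: dprod_projP => i; rewrite !dprod_projE mulrDr. Qed.

HB.instance Definition _ := GRing.Zmodule_isPzRing.Build (dprod_ring X)
  dprod_mulA dprod_mul1 dprod_mulr1 dprod_mulDl dprod_mulDr.

Fact dprod_proj_zmod i : zmod_morphism (@dprod_proj i).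
Proof. by move=> f g; rewrite !dprod_projE. Qed.
Fact dprod_proj_monoid i : monoid_morphism (@dprod_proj i).
Proof. by split=> [|f g]; rewrite dprod_projE. Qed.

HB.instance Definition _ i :=
  GRing.isZmodMorphism.Build (dprod_ring X) (X i) (@dprod_proj i)
    (dprod_proj_zmod i).
HB.instance Definition _ i :=
  GRing.isMonoidMorphism.Build (dprod_ring X) (X i) (@dprod_proj i)
    (dprod_proj_monoid i).

Section Pairing.
Variables (Q : finPzRingType) (q : forall i, {rmorphism Q -> X i}).

Definition dprod_pair (a : Q) : dprod_ring X := dprod_of (fun i => q i a).

Fact dprod_pair_zmod : zmod_morphism dprod_pair.
Proof.
by move=> a b; apply: dprod_projP => i; rewrite rmorphB /= !dprod_projE rmorphB.
Qed.
Fact dprod_pair_monoid : monoid_morphism dprod_pair.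
Proof.
split=> [|a b]; apply: dprod_projP => i.
  by rewrite dprod_projE !rmorph1.
by rewrite rmorphM /= !dprod_projE rmorphM.
Qed.

HB.instance Definition _ :=
  GRing.isZmodMorphism.Build Q (dprod_ring X) dprod_pair dprod_pair_zmod.
HB.instance Definition _ :=
  GRing.isMonoidMorphism.Build Q (dprod_ring X) dprod_pair dprod_pair_monoid.
End Pairing.
End DProdRing.

Section FinRingProduct.
Variables (I : finType) (X : I -> finPzRingType) (P : finPzRingType).
Variable p : forall i, {rmorphism P -> X i}.
Hypothesis prodP : @is_product FinRing I X P p.

Lemma product_lift (Q : finPzRingType) (q : forall i, {rmorphism Q -> X i}) :
  exists h : {rmorphism Q -> P}, forall i c, p i (h c) = q i c.
Proof.
have [h [hq _]] := prodP q; exists h => i c.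
exact: (congr1 (fun k : {rmorphism Q -> X i} => k c) (hq i)).
Qed.

(** Both [h] and the identity are mediating maps for the cone [p] over itself, so uniqueness
    identifies them. *)
Lemma product_endo_id (h : {rmorphism P -> P}) :
  (forall i c, p i (h c) = p i c) -> h =1 id.
Proof.
move=> hp c; have [g [_ guniq]] := prodP p.
have gh : g = h by apply: guniq => i; apply: rmorphism_eq => d; apply: hp.
have gid : g = (idfun : {rmorphism P -> P}).
  by apply: guniq => i; apply: rmorphism_eq.
by rewrite -gh gid.
Qed.

(** The concrete ring of families is a cone over [X]; its mediating map to [P] sends the family [x]
    to the desired element. *)
Lemma product_surj (x : forall i, X i) : exists a, forall i, p i a = x i.
Proof.
have [h hp] :=
  product_lift (fun i => @dprod_proj I X i : {rmorphism _ -> _}).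
by exists (h (dprod_of x)) => i; rewrite hp; apply: dprod_projE.
Qed.

(** An element can be recovered from its family of components, by the mediating map out of the
    concrete product. For empty [I] this says that [P] is the zero ring. *)
Lemma product_inj (a b : P) : (forall i, p i a = p i b) -> a = b.
Proof.
move=> pab.
have [h hp] :=
  product_lift (fun i => @dprod_proj I X i : {rmorphism _ -> _}).
(* The round trip through the concrete product commutes with every [p i], hence is the identity. *)
have hk : (h \o dprod_pair p : {rmorphism P -> P}) =1 id.
  by apply: product_endo_id => i c; rewrite /= hp; apply: dprod_projE.
rewrite -(hk a) -(hk b) /=; congr (h _).
by apply: dprod_projP => i; rewrite !dprod_projE pab.
Qed.

(** Inverses of the components lift to one element by surjectivity, and injectivity verifies both
    inverse laws. *)
Lemma product_is_unit (u : P) : (forall i, is_unit (p i u)) -> is_unit u.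
Proof.
move=> uu; have [v vP] := dep_choice (fun i => is_unitP _ (uu i)).
have [w wP] := product_surj v; apply/is_unitP; exists w.
by split; apply: product_inj => i; rewrite rmorphM rmorph1 /= wP; case: (vP i).
Qed.

(** The right and left multipliers are lifted separately from the factors. Their lifts are units
    because all their components are. *)
Lemma product_assoc (a b : P) :
  (forall i, assoc_rel (p i a) (p i b)) -> assoc_rel a b.
Proof.
move=> ab; have [u uP] := dep_choice (fun i => assoc_relP _ _ (ab i)).
have [v {}uP] := dep_choice uP.
have [u' u'P] := product_surj u; have [v' v'P] := product_surj v.
apply/assoc_relP; exists u', v'; split.
- by apply: product_is_unit => i; rewrite u'P; case: (uP i).
- by apply: product_is_unit => i; rewrite v'P; case: (uP i).
- by apply: product_inj => i; rewrite rmorphM /= u'P; case: (uP i).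
- by apply: product_inj => i; rewrite rmorphM /= v'P; case: (uP i).
Qed.

(** This yields uniqueness of mediating graph homomorphisms: a vertex over [P] is determined by its
    images in the factors. *)
Lemma product_theta_inj (A B : assoc_class P) :
  (forall i, theta_vmap (p i) A = theta_vmap (p i) B) -> A = B.
Proof.
have [a ->] := class_of_surj A; have [b ->] := class_of_surj B => pab.
apply/class_ofP/product_assoc => i.
by apply/class_ofP; rewrite -!theta_vmapE.
Qed.

Lemma product_theta_surj (A : forall i, assoc_class (X i)) :
  exists B : assoc_class P, forall i, theta_vmap (p i) B = A i.
Proof.
have [x xP] := dep_choice (fun i => class_of_surj (A i)).
have [a aP] := product_surj x.
by exists (class_of a) => i; rewrite theta_vmapE aP.
Qed.

(** A product in [P] vanishes once all its components do. Edges are thus reflected jointly by the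
    projections, as in a tensor product of graphs. *)
Lemma product_theta_edge (A B : assoc_class P) :
  (forall i, theta_edge (theta_vmap (p i) A) (theta_vmap (p i) B)) ->
  theta_edge A B.
Proof.
have [a ->] := class_of_surj A; have [b ->] := class_of_surj B => pab.
apply/theta_edgeE/product_inj => i; rewrite rmorphM rmorph0.
by apply/theta_edgeE; rewrite -!theta_vmapE.
Qed.

End FinRingProduct.

Theorem proposition2p8 : preserves_finite_products Theta.
Proof.
move=> I X P p prodP G q.
(* The mediating map is first chosen on vertices only; edge preservation follows from the joint
   reflection of edges. *)
have [h hP] := choice (fun v : (G : digraph) =>
  product_theta_surj prodP (fun i => (q i : digraph_hom _ _) v)).
have h_edge (v w : (G : digraph)) : edge v w -> @edge (theta_obj P) (h v) (h w).
  move=> vw; apply: (product_theta_edge prodP) => i.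
  rewrite !hP; exact: (vmap_edge (q i : digraph_hom _ _) vw).
exists (DigraphHom h_edge); split=> [i|g gq].
  by apply: digraph_hom_eq => v; apply: hP.
(* Any competitor [g] has the same components as [h] at each vertex. *)
apply: digraph_hom_eq => v; apply: (product_theta_inj prodP) => i.
by rewrite hP -(gq i).
Qed.
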